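(* Let $\mathbf X$ be a recursive ML model on a DAG $\mathcal D=(V,E)$ with ML coefficient matrix $B=(b_{ij})_{d\times d}$, and let $U\subseteq V$ be non-empty. Let $\mathrm{An}^U_{\mathrm{low}}(i)$ be the set of lowest max-weighted ancestors of node $i$ in $U$, and define $\mathrm{An}^U_{\mathrm{nmw}}(i):=(\mathrm{an}^U_{\mathrm{nmw}}(i)\cup\{i\})\cap U^c$. Then for every $i\in V$, $$X_i=\bigvee_{k\in\mathrm{An}^U_{\mathrm{low}}(i)}\frac{b_{ki}}{b_{kk}}X_k\vee\bigvee_{j\in\mathrm{An}^U_{\mathrm{nmw}}(i)}b_{ji}Z_j.$$ This representation of $X_i$ as a max-linear function of $\mathbf X_U=(X_l,\ l\in U)$ and noise variables involves the minimum number of components of $\mathbf X_U$ and the minimum number of noise variables.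
   Context: Let $\mathcal D=(V,E)$ be a directed acyclic graph (DAG) with $V=\{1,\dots,d\}$. For $i\in V$, $\mathrm{pa}(i)$ and $\mathrm{an}(i)$ are the parents and ancestors of $i$ (ancestors via directed paths of length at least one); $\mathrm{An}(i)=\mathrm{an}(i)\cup\{i\}$; $U^c=V\setminus U$. All paths are directed and of length at least one; $P_{ji}$ is the set of paths from $j$ to $i$; a path passes through all its nodes including its endpoints. A recursive max-linear (ML) model on $\mathcal D$ is a random vector $\mathbf X=(X_1,\dots,X_d)$ defined recursively by $X_i=\bigvee_{k\in \mathrm{pa}(i)} c_{ki}X_k\vee c_{ii}Z_i$, $i=1,\dots,d$, with independent non-negative random variables $Z_1,\dots,Z_d$ (noise variables), each with support $\mathbb R_+=[0,\infty)$, and positive weights $c_{ki}$, $k\in\mathrm{pa}(i)\cup\{i\}$. The weight of a path $p=[j=k_0\to k_1\to\dots\to k_n=i]$ is $d_{ji}(p)=c_{k_0,k_0}\prod_{l=0}^{n-1}c_{k_l,k_{l+1}}$. The ML coefficient matrix $B=(b_{ij})_{d\times d}$ of $\mathbf X$ is given, for $i\in V$, by $b_{ji}=\bigvee_{p\in P_{ji}}d_{ji}(p)$ for $j\in\mathrm{an}(i)$, $b_{ii}=c_{ii}$, and $b_{ji}=0$ for $j\in V\setminus\mathrm{An}(i)$; with it, $X_i=\bigvee_{j\in\mathrm{An}(i)}b_{ji}Z_j$ for all $i\in V$. A path $p$ from $j$ to $i$ is max-weighted if $b_{ji}=d_{ji}(p)$. A node $j\in\mathrm{An}(i)\cap U$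 is a lowest max-weighted ancestor of $i$ in $U$ if no max-weighted path from $j$ to $i$ passes through some node in $U\setminus\{j\}$; the set of these is $\mathrm{An}^U_{\mathrm{low}}(i)$. $\mathrm{an}^U_{\mathrm{nmw}}(i)$ is the set of all $j\in\mathrm{an}(i)$ such that no max-weighted path from $j$ to $i$ passes through some node in $U$. A maximum over the empty set is $0$.
   Formalization: The two numbers cannot be minimal separately (using all noise variables needs no component of X_U); noise count is minimal over all representations, component count over those with the minimum noise count or with noise variables only from U^c. *)

(* Defs.v *)
From mathcomp Require Import all_boot all_order all_algebra.
From mathcomp Require Import all_classical all_reals all_analysis.
Set Implicit Arguments.
Unset Strict Implicit.
Unset Printing Implicit Defensive.
Import Order.TTheory GRing.Theory Num.Theory.
Import numFieldNormedType.Exports.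
Local Open Scope ring_scope.

(* [e k i] is the edge k -> i. A path j = k_0 -> k_1 -> ... -> k_n = i with
   n >= 1 is represented by its start j and the list p = [:: k_1; ...; k_n];
   its nodes are those of j :: p. *)
Definition dipath d (e : rel 'I_d) (j i : 'I_d) (p : seq 'I_d) : bool :=
  [&& path e j p, p != [::] & last j p == i].

Definition acyclic d (e : rel 'I_d) : Prop :=
  forall (i : 'I_d) (p : seq 'I_d), ~~ dipath e i i p.

Definition pa d (e : rel 'I_d) (i : 'I_d) : {set 'I_d} :=
  [set k | e k i]%SET.

Definition an d (e : rel 'I_d) (i : 'I_d) : {set 'I_d} :=
  [set j | `[< exists p, dipath e j i p >]]%SET.

Definition An d (e : rel 'I_d) (i : 'I_d) : {set 'I_d} := (i |: an e i)%SET.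

Definition path_weight (R : realType) d (c : 'M[R]_d) (j : 'I_d)
    (p : seq 'I_d) : R :=
  c j j * \prod_(x <- pairmap c j p) x.

(* In a DAG the set of paths from j to i is finite, so that the supremum is a
   maximum. *)
Definition ml_coef (R : realType) d (e : rel 'I_d) (c : 'M[R]_d) : 'M[R]_d :=
  \matrix_(j, i)
    if j == i then c i i
    else if j \in an e i
      then sup [set path_weight c j p | p in [set p | dipath e j i p]]%classic
    else 0.

Definition max_weighted (R : realType) d (e : rel 'I_d) (c : 'M[R]_d)
    (j i : 'I_d) (p : seq 'I_d) : Prop :=
  dipath e j i p /\ ml_coef e c j i = path_weight c j p.

Definition passes_through d (j : 'I_d) (p : seq 'I_d) (W : {set 'I_d}) : bool :=
  has (mem W) (j :: p).

Definition An_low (R : realType) d (e : rel 'I_d) (c : 'M[R]_d)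
    (U : {set 'I_d}) (i : 'I_d) : {set 'I_d} :=
  [set j in An e i :&: U |
    `[< forall p, max_weighted e c j i p -> ~~ passes_through j p (U :\ j) >]]%SET.

Definition an_nmw (R : realType) d (e : rel 'I_d) (c : 'M[R]_d)
    (U : {set 'I_d}) (i : 'I_d) : {set 'I_d} :=
  [set j in an e i |
    `[< forall p, max_weighted e c j i p -> ~~ passes_through j p U >]]%SET.

Definition An_nmw (R : realType) d (e : rel 'I_d) (c : 'M[R]_d)
    (U : {set 'I_d}) (i : 'I_d) : {set 'I_d} :=
  ((i |: an_nmw e c U i) :&: ~: U)%SET.

Definition mutually_independent (disp : measure_display)
    (T : measurableType disp) (R : realType) (P : probability T R) d
    (Z : 'I_d -> {RV P >-> R}) : Prop :=
  forall (S : {set 'I_d}) (B : 'I_d -> set R),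
    (forall i, measurable (B i)) ->
    P (\bigcap_(i in [set i | i \in S]) (Z i @^-1` B i))%classic =
    (\prod_(i in S) P (Z i @^-1` B i)%classic)%E.

Definition rv_support (disp : measure_display)
    (T : measurableType disp) (R : realType) (P : probability T R)
    (Y : {RV P >-> R}) : set R :=
  [set x | forall O : set R, open O -> O x -> (0 < P (Y @^-1` O))%E]%classic.

Definition recursive_ml_model (disp : measure_display)
    (T : measurableType disp) (R : realType) (P : probability T R) d
    (e : rel 'I_d) (c : 'M[R]_d) (Z X : 'I_d -> {RV P >-> R}) : Prop :=
  [/\ forall i k, k \in (i |: pa e i)%SET -> 0 < c k i,
      mutually_independent Z,
      forall i w, 0 <= Z i w,
      forall i, rv_support (Z i) = [set x | 0 <= x]%classic
    & forall i w, X i w =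
        Num.max (\big[Num.max/0]_(k in pa e i) (c k i * X k w))
                (c i i * Z i w)].

(* The max-linear function of (X_k, k in A) and (Z_j, j in C) with
   coefficients a and b. *)
Definition max_linear (T : Type) (R : realType) d (X Z : 'I_d -> T -> R)
    (A C : {set 'I_d}) (a b : 'I_d -> R) (w : T) : R :=
  Num.max (\big[Num.max/0]_(k in A) (a k * X k w))
          (\big[Num.max/0]_(j in C) (b j * Z j w)).

(* X_i is almost surely a max-linear function of the components of X_U with
   indices in A and the noise variables with indices in C, where C may meet U. *)
Definition ml_representation (disp : measure_display)
    (T : measurableType disp) (R : realType) (P : probability T R) d
    (X Z : 'I_d -> {RV P >-> R}) (U : {set 'I_d}) (i : 'I_d)
    (A C : {set 'I_d}) (a b : 'I_d -> R) : Prop :=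
  [/\ A \subset U,
      forall k, k \in A -> 0 <= a k,
      forall j, j \in C -> 0 <= b j
    & {ae P, forall w, X i w = max_linear X Z A C a b w}].

(* Main.v *)
Require Import Defs.
From mathcomp Require Import all_boot all_order all_algebra.
From mathcomp Require Import all_classical all_reals all_analysis.
From mathcomp Require Import ring.
Import Order.TTheory GRing.Theory Num.Theory.
Import numFieldNormedType.Exports.
Local Open Scope ring_scope.
Set Implicit Arguments.
Unset Strict Implicit.
Unset Printing Implicit Defensive.

(** Everything about the graph that matters is a property of the matrix [B].
    Concatenating paths gives [B j k * B k i <= B j i * B k k], and equality
    (with [B j i] positive) says exactly that some heaviest path from [j] to
    [i] passes through [k] ([factors_heaviest_walk]); we then say that
    [B j i] factors through [k].  Hence [An_low] consists of the ancestors [k]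
    in [U] for which [B k i] factors through no other node of [U], and [An_nmw]
    of the ancestors [j], with [i] itself included, for which [B j i] factors
    through no node of [U] at all ([An_lowE], [An_nmwE]).

    Solving the recursion along the DAG gives [X_k = max_j B j k * Z_j] for all
    [k] ([ml_solution]).

    Representation ([max_linear_low_free]).  The triangle inequality says that
    [(B k i / B k k) * X_k] never exceeds [X_i].  Conversely, consider a term
    [B j i * Z_j] of [X_i].  If [j] is not in [An_nmw], then [B j i] factors
    through some node of [U]; the last such node [l] in a topological order is
    in [An_low], since a further factorization of [B l i] would yield a later
    one of [B j i] ([factors_low]).  So [B j i * Z_j] is dominated by the term
    of [X_l].

    Minimality.  Substituting the solution for the [X_k] in any other
    representation turns it into an almost sure identity between two max-linear
    functions of the noise.  Independence and full support put positive
    probability on every open box that meets the orthant; a box where [Z_j]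
    exceeds [1] and all other noise variables are small isolates the [j]-th
    coefficients, which are therefore equal ([le_max_linear_coef]).  This gives
    [B j i = max (max_(k in A) a k * B j k, b j)], with [b j] present only for
    [j] in [C].  In particular [a k <= B k i / B k k], so that a term
    [a k * B j k] can attain [B j i] only if [B j i] factors through [k].
    For [j] in [An_nmw] this is excluded for every [k] in [A], which forces [j]
    into [C] ([free_ancestors_sub]); for [j] in [An_low] it leaves only [k = j],
    which forces [j] into [A] as soon as [C] avoids [U] ([low_ancestors_sub]).
    If [C] has the minimum number of elements, then it equals [An_nmw] and
    avoids [U]. *)

(** * Maxima of nonnegative families *)

Lemma mul_bigmax_le (R : realDomainType) (I : finType) (P : pred I)
    (F : I -> R) (a y : R) :
    0 <= y -> (forall j, P j -> a * F j <= y) ->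
  a * \big[Num.max/0]_(j | P j) F j <= y.
Proof.
move=> y_ge0 aF; elim/big_ind: _ => [|u v u_le v_le|]; last exact: aF.
- by rewrite mulr0.
- by rewrite maxEle; case: ifP.
Qed.

Lemma bigmax0_ge0 (R : realDomainType) (I : finType) (P : pred I) (F : I -> R) :
  0 <= \big[Num.max/0]_(j | P j) F j.
Proof. by apply/bigmax_geP; left. Qed.

(** * Matrices satisfying the triangle inequality of path weights *)

Section CoefficientMatrix.

Variables (R : realFieldType) (d : nat) (B : 'M[R]_d) (rk : 'I_d -> nat).
Hypothesis B_diag_gt0 : forall k, 0 < B k k.
Hypothesis B_ge0 : forall j i, 0 <= B j i.
Hypothesis B_factor_le : forall j k i, B j k * B k i <= B j i * B k k.
Hypothesis B_rank : forall j i, 0 < B j i -> j != i -> (rk j < rk i)%N.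

(** In terms of paths, when [B j i] is positive: some heaviest path from [j] to
    [i] visits [k]. *)
Definition factors j k i := B j k * B k i == B j i * B k k.

(** The algebraic form of the lowest max-weighted ancestors of [i] in [U]. *)
Definition low_ancestors (U : {set 'I_d}) i : {set 'I_d} :=
  [set k in U | (0 < B k i) && [forall l in U :\ k, ~~ factors k l i]]%SET.

(** Since [B j i] always factors through [j], no element of [U] is in this
    set. *)
Definition free_ancestors (U : {set 'I_d}) i : {set 'I_d} :=
  [set j | (0 < B j i) && [forall k in U, ~~ factors j k i]]%SET.

Lemma factors_start j i : factors j j i.
Proof. by rewrite /factors mulrC. Qed.

Lemma factor_coef_le j k i : B k i / B k k * B j k <= B j i.
Proof. by rewrite mulrAC ler_pdivrMr // mulrC B_factor_le. Qed.

Lemma factorsE j k i : factors j k i = (B k i / B k k * B j k == B j i).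
Proof.
rewrite /factors mulrAC [B k i * _]mulrC.
by rewrite -[RHS](inj_eq (mulIf (lt0r_neq0 (B_diag_gt0 k)))) divfK ?lt0r_neq0.
Qed.

Lemma factors_gt0 j k i :
  0 < B j i -> factors j k i -> 0 < B j k /\ 0 < B k i.
Proof.
move=> Bji /eqP jki; have : 0 < B j k * B k i by rewrite jki mulr_gt0.
rewrite lt_neqAle mulr_ge0 // andbT eq_sym mulf_eq0 => /norP[].
by rewrite !lt_neqAle !B_ge0 ![0 == _]eq_sym => -> ->.
Qed.

(** The two factorizations multiply to
    [B j i * B l l * B m m = B j l * B l m * B m i], and [B j l * B l m] is at
    most [B j m * B l l]. *)
Lemma factors_trans j l m i : factors j l i -> factors l m i -> factors j m i.
Proof.
move=> /eqP jli /eqP lmi; rewrite /factors eq_le B_factor_le /=.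
rewrite -(ler_pM2r (B_diag_gt0 l)) mulrAC -jli -mulrA -lmi mulrA [leRHS]mulrAC.
by rewrite ler_wpM2r.
Qed.

(** Among the nodes of [U] through which [B j i] factors, one of maximal rank is
    lowest, because by transitivity any node refuting this would have larger
    rank. *)
Lemma factors_low (U : {set 'I_d}) i j k :
    0 < B j i -> k \in U -> factors j k i ->
  exists2 l, l \in low_ancestors U i & factors j l i.
Proof.
move=> Bji kU jki.
have Pk : (k \in U) && factors j k i by rewrite kU.
pose P := [pred l | (l \in U) && factors j l i].
case: (@arg_maxnP _ k P rk Pk) => l /= /andP[lU jli] l_max.
exists l => //; have [_ Bli] := factors_gt0 Bji jli.
rewrite !inE lU Bli; apply/forall_inP => m; rewrite !inE => /andP[ml mU].
apply/negP => lmi; have [Blm _] := factors_gt0 Bli lmi.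
have := l_max m; rewrite mU (factors_trans jli lmi) => /(_ isT).
by rewrite /geq /= leqNgt B_rank // eq_sym.
Qed.

Lemma max_linear_low_free (U : {set 'I_d}) i (x z : 'I_d -> R) :
    (forall j, 0 <= z j) -> (forall k, x k = \big[Num.max/0]_j (B j k * z j)) ->
  x i = Num.max (\big[Num.max/0]_(k in low_ancestors U i) (B k i / B k k * x k))
                (\big[Num.max/0]_(j in free_ancestors U i) (B j i * z j)).
Proof.
move=> z_ge0 xE.
have coef_ge0 k : 0 <= B k i / B k k by rewrite divr_ge0.
have x_ge k j : B j k * z j <= x k by rewrite xE le_bigmax.
have x_ge0 k : 0 <= x k by apply: le_trans (x_ge k k); rewrite mulr_ge0.
apply/le_anti/andP; split; last first.
  rewrite ge_max; apply/andP; split; apply: bigmax_le => // k _.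
  rewrite xE; apply: mul_bigmax_le => // j _; apply: le_trans (x_ge i j).
  by rewrite mulrA ler_wpM2r // factor_coef_le.
rewrite {1}xE; apply: bigmax_le => [|j _].
  by rewrite le_max bigmax0_ge0.
have [Bji|] := ltP 0 (B j i); last first.
  move=> Bji; have -> : B j i = 0 by apply/le_anti; rewrite Bji B_ge0.
  by rewrite mul0r le_max bigmax0_ge0.
have [j_nmw|] := boolP (j \in free_ancestors U i).
  by rewrite le_max (@le_bigmax_cond _ _ _ _ j) // orbT.
rewrite inE Bji /= => /forall_inPn[k kU /negPn jki].
have [l l_low] := factors_low Bji kU jki.
rewrite factorsE => /eqP <-; rewrite le_max; apply/orP; left.
apply: (@bigmax_sup _ _ _ _ l) => //.
by rewrite -mulrA ler_wpM2l.
Qed.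

(** The coefficient of the [j]-th noise variable once the components [x k] are
    replaced by their own max-linear expressions in the noise. *)
Definition noise_coef (A C : {set 'I_d}) (a b : 'I_d -> R) j : R :=
  Num.max (\big[Num.max/0]_(k in A) (a k * B j k)) (if j \in C then b j else 0).

Lemma max_linear_noise (A C : {set 'I_d}) (a b x z : 'I_d -> R) :
    (forall j, 0 <= z j) -> (forall k, x k = \big[Num.max/0]_j (B j k * z j)) ->
    (forall k, k \in A -> 0 <= a k) ->
  Num.max (\big[Num.max/0]_(k in A) (a k * x k))
          (\big[Num.max/0]_(j in C) (b j * z j)) =
  \big[Num.max/0]_j (noise_coef A C a b j * z j).
Proof.
move=> z_ge0 xE a_ge0; set m := noise_coef A C a b.
have m_le j y : y <= m j -> y * z j <= \big[Num.max/0]_j (m j * z j).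
  by move=> y_le; apply: (bigmax_sup j) => //; rewrite ler_wpM2r.
apply/le_anti/andP; split; last first.
  apply: bigmax_le => [|j _]; first by rewrite le_max bigmax0_ge0.
  rewrite mulrC /m /noise_coef maxr_pMr // ge_max.
  apply/andP; split; last first.
    rewrite mulrC le_max; apply/orP; right; case: ifP => jC.
      exact: (@le_bigmax_cond _ _ _ _ j).
    by rewrite mul0r bigmax0_ge0.
  rewrite le_max; apply/orP; left.
  apply: mul_bigmax_le => [|k kA]; first exact: bigmax0_ge0.
  apply: (bigmax_sup k) => //; rewrite mulrCA ler_wpM2l ?a_ge0 //.
  by rewrite mulrC xE (@le_bigmax _ _ _ _ (fun j => B j k * z j)).
rewrite ge_max; apply/andP; split; apply: bigmax_le => [|k k_in].
- exact: bigmax0_ge0.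
- rewrite xE; apply: mul_bigmax_le => [|j _]; first exact: bigmax0_ge0.
  rewrite mulrA m_le // le_max; apply/orP; left.
  exact: (@le_bigmax_cond _ _ _ _ k).
- exact: bigmax0_ge0.
- by rewrite m_le // le_max k_in lexx orbT.
Qed.

Section Minimality.

Variables (U A C : {set 'I_d}) (i : 'I_d) (a b : 'I_d -> R).
Hypothesis A_sub : A \subset U.
Hypothesis B_iE : forall j, B j i = noise_coef A C a b j.

(** Comparing the coefficients of the noise variable of [k] itself. *)
Let a_le k : k \in A -> a k <= B k i / B k k.
Proof.
move=> kA; rewrite ler_pdivlMr // [leRHS]B_iE le_max; apply/orP; left.
exact: (@le_bigmax_cond _ _ _ _ k).
Qed.

Let a_term_lt j k : k \in A -> ~~ factors j k i -> a k * B j k < B j i.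
Proof.
move=> kA; rewrite factorsE => jki.
apply: (@le_lt_trans _ _ (B k i / B k k * B j k)).
  by rewrite ler_wpM2r // a_le.
by rewrite lt_neqAle jki factor_coef_le.
Qed.

(** The maximum defining [B j i] is attained either by the explicit noise term
    or by a component [k]; by [a_term_lt] the latter requires factorization. *)
Let coef_source j : 0 < B j i ->
  j \in C \/ exists2 k, k \in A & factors j k i.
Proof.
move=> Bji; have [jC|jC] := boolP (j \in C); [by left | right].
apply: contrapT => no_k; have := ltxx (B j i).
rewrite {1}B_iE /noise_coef (negbTE jC) gt_max Bji andbT bigmax_lt // => k kA.
by apply: a_term_lt => //; apply/negP => jki; apply: no_k; exists k.
Qed.

Lemma free_ancestors_sub : free_ancestors U i \subset C.
Proof.
apply/fintype.subsetP => j; rewrite inE => /andP[Bji /forall_inP nf].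
have [//|[k kA jki]] := coef_source Bji.
by have := nf k (fintype.subsetP A_sub k kA); rewrite jki.
Qed.

Lemma low_ancestors_sub : C \subset (~: U)%SET -> low_ancestors U i \subset A.
Proof.
move=> CU; apply/fintype.subsetP => k.
rewrite !inE => /and3P[kU Bki /forall_inP nf].
have [kC|[l lA kli]] := coef_source Bki.
  by have := fintype.subsetP CU k kC; rewrite inE kU.
have [<- //|lk] := eqVneq l k.
have := nf l; rewrite !inE lk (fintype.subsetP A_sub l lA) kli.
by move=> /(_ isT).
Qed.

End Minimality.

End CoefficientMatrix.

(** * Directed walks in an acyclic graph *)

Section Walks.

Variables (d : nat) (e : rel 'I_d).

(** Unlike [dipath], this admits the empty walk from a node to itself, whose
    weight is the diagonal weight; the diagonal of the coefficient matrix then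
    needs no separate treatment. *)
Definition walk (j i : 'I_d) (p : seq 'I_d) : bool :=
  path e j p && (last j p == i).

(** In an acyclic graph this increases strictly along edges, and so orders the
    nodes topologically. *)
Definition ancestor_rank (i : 'I_d) : nat := #|an e i|.

Lemma anP j i : reflect (exists p, dipath e j i p) (j \in an e i).
Proof. by rewrite inE; apply: asboolP. Qed.

Lemma AnP j i : reflect (exists p, walk j i p) (j \in An e i).
Proof.
rewrite in_setU1; apply: (iffP orP) => [[/eqP ->|/anP[p]]|[[|k p]]].
- by exists [::]; rewrite /walk /= eqxx.
- by move=> /and3P[ep _ lp]; exists p; rewrite /walk ep.
- by move=> /= /eqP; left; apply/eqP.
- by move=> /andP[ep lp]; right; apply/anP; exists (k :: p); apply/and3P.
Qed.

Lemma walk_cat j k i p q : walk j k p -> walk k i q -> walk j i (p ++ q).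
Proof.
move=> /andP[ep /eqP lp] /andP[eq lq].
by rewrite /walk cat_path last_cat lp ep eq.
Qed.

Lemma walk_split j i k p : k \in j :: p -> walk j i p ->
  exists q r, [/\ p = q ++ r, walk j k q & walk k i r].
Proof.
case/splitPl: p / => q r lq.
rewrite /walk cat_path last_cat lq => /andP[/andP[eq er] lr].
by exists q, r; rewrite lq eq er lr eqxx.
Qed.

Hypothesis e_acyclic : acyclic e.

Lemma closed_walk_nil i p : walk i i p -> p = [::].
Proof.
case: p => // k p /andP[ep lp].
by have := e_acyclic i (k :: p); rewrite /dipath ep lp.
Qed.

Lemma ancestor_rank_edge k i : e k i -> (ancestor_rank k < ancestor_rank i)%N.
Proof.
move=> eki; apply/proper_card/properP; split.
  apply/fintype.subsetP => j /anP[p /and3P[ep _ /eqP lp]].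
  apply/anP; exists (rcons p i).
  by rewrite /dipath rcons_path last_rcons ep lp eki eqxx; case: (p).
exists k; first by apply/anP; exists [:: i]; rewrite /dipath /= eki eqxx.
by apply/anP => -[p]; apply/negP.
Qed.

Let path_rank j p : path e j p -> path (relpre ancestor_rank ltn) j p.
Proof. exact/sub_path/ancestor_rank_edge. Qed.

Let rank_trans : transitive (relpre ancestor_rank ltn).
Proof. by move=> y x z; apply: ltn_trans. Qed.

Lemma ancestor_rank_walk j i p : walk j i p -> j != i ->
  (ancestor_rank j < ancestor_rank i)%N.
Proof.
move=> /andP[/path_rank/(order_path_min rank_trans)/allP p_min /eqP <-] ji.
apply: p_min; have := mem_last j p.
by rewrite in_cons eq_sym (negbTE ji).
Qed.

(** The rank increases strictly along a walk, so that no node is repeated. *)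
Lemma size_walk j i p : walk j i p -> (size p <= d)%N.
Proof.
move=> /andP[ep _]; apply: ltnW.
have Up : uniq (j :: p).
  apply: (@sorted_uniq _ (relpre ancestor_rank ltn)) => //.
    by move=> x; apply: ltnn.
  exact: path_rank.
by have := max_card (mem (j :: p)); rewrite (card_uniqP Up) card_ord.
Qed.

(** Walks have length at most [d], so that they form a finite type. *)
Lemma ex_heaviest_walk (R : realDomainType) (w : seq 'I_d -> R) j i :
    j \in An e i ->
  exists2 p, walk j i p & forall q, walk j i q -> w q <= w p.
Proof.
case/AnP => p0 wp0.
pose P := [pred p : d.-bseq 'I_d | walk j i p].
have P0 : P (Bseq (size_walk wp0)) by [].
case: (@arg_maxP _ _ _ _ P (fun p : d.-bseq 'I_d => w p) P0) => p wp p_max.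
by exists p => // q wq; apply: (p_max (Bseq (size_walk wq))).
Qed.

(** * The max-linear coefficient matrix *)

Section Weights.

Variables (R : realType) (c : 'M[R]_d).
Hypothesis c_gt0 : forall i k, k \in (i |: pa e i)%SET -> 0 < c k i.

Let B := ml_coef e c.

Lemma c_diag_gt0 i : 0 < c i i.
Proof. by apply: c_gt0; rewrite setU11. Qed.

Lemma c_edge_gt0 k i : e k i -> 0 < c k i.
Proof. by move=> eki; apply: c_gt0; rewrite !inE eki orbT. Qed.

Lemma path_weight_nil j : path_weight c j [::] = c j j.
Proof. by rewrite /path_weight big_nil mulr1. Qed.

(** The diagonal factor makes up for the initial weight of the second part,
    which the concatenated path does not have. *)
Lemma path_weight_cat j p q :
  path_weight c j (p ++ q) * c (last j p) (last j p) =
  path_weight c j p * path_weight c (last j p) q.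
Proof. by rewrite /path_weight pairmap_cat big_cat /=; ring. Qed.

Lemma path_weight_rcons j p i :
  path_weight c j (rcons p i) = path_weight c j p * c (last j p) i.
Proof.
by rewrite /path_weight -cats1 pairmap_cat big_cat /= big_seq1 mulrA.
Qed.

Lemma path_weight_gt0 j p : path e j p -> 0 < path_weight c j p.
Proof.
elim/last_ind: p => [|p i IHp]; first by rewrite path_weight_nil c_diag_gt0.
rewrite rcons_path path_weight_rcons => /andP[/IHp p_gt0 e_i].
by rewrite mulr_gt0 // c_edge_gt0.
Qed.

Lemma ml_coef_eq0 j i : j \notin An e i -> B j i = 0.
Proof.
by rewrite in_setU1 negb_or mxE => /andP[/negbTE-> /negbTE->].
Qed.

(** The supremum defining the coefficient is attained, and the diagonal entries
    obey the same description by walks as the others. *)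
Lemma ml_coef_max j i : j \in An e i ->
  exists2 p, walk j i p /\ B j i = path_weight c j p
           & forall q, walk j i q -> path_weight c j q <= B j i.
Proof.
move=> jAn; have [p wp p_max] := ex_heaviest_walk (path_weight c j) jAn.
suff Bji : B j i = path_weight c j p by exists p => //; rewrite Bji.
rewrite mxE; have [ji|ji] := eqVneq j i.
  by rewrite ji in wp *; rewrite (closed_walk_nil wp) path_weight_nil.
move: (jAn); rewrite in_setU1 (negbTE ji) /= => ->.
have dipath_walk q : dipath e j i q = walk j i q.
  by rewrite /dipath /walk; case: q => //=; rewrite (negbTE ji).
set S := (X in sup X).
have S_ub : ubound S (path_weight c j p).
  by move=> y [q /=]; rewrite dipath_walk => wq <-; apply: p_max.
have Sp : S (path_weight c j p) by exists p => //=; rewrite dipath_walk.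
apply/le_anti/andP; split.
  by apply: ge_sup => //; exists (path_weight c j p).
by apply: ub_le_sup => //; exists (path_weight c j p).
Qed.

Lemma ml_coef_ge j i p : walk j i p -> path_weight c j p <= B j i.
Proof.
move=> wp; have /ml_coef_max[? _ B_ge] : j \in An e i by apply/AnP; exists p.
exact: B_ge.
Qed.

Lemma ml_coef_gt0 j i : (0 < B j i) = (j \in An e i).
Proof.
have [jAn|/ml_coef_eq0->] := boolP (j \in An e i); last by rewrite ltxx.
by have [p [/andP[ep _] ->] _] := ml_coef_max jAn; apply: path_weight_gt0.
Qed.

Lemma ml_coef_ge0 j i : 0 <= B j i.
Proof.
have [jAn|/ml_coef_eq0->//] := boolP (j \in An e i).
by rewrite ltW // ml_coef_gt0.
Qed.

Lemma ml_coef_diag i : B i i = c i i.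
Proof. by rewrite mxE eqxx. Qed.

Lemma ml_coef_diag_gt0 i : 0 < B i i.
Proof. by rewrite ml_coef_diag c_diag_gt0. Qed.

Lemma ml_coef_walk j i : 0 < B j i ->
  exists2 p, walk j i p & B j i = path_weight c j p.
Proof. by rewrite ml_coef_gt0 => /ml_coef_max[p [wp Bp] _]; exists p. Qed.

Lemma path_weight_factor j k i p q : walk j k p -> walk k i q ->
  path_weight c j (p ++ q) * B k k = path_weight c j p * path_weight c k q.
Proof. by move=> /andP[_ /eqP <-] _; rewrite ml_coef_diag path_weight_cat. Qed.

Lemma ml_coef_factor_le j k i : B j k * B k i <= B j i * B k k.
Proof.
have ge0 : 0 <= B j i * B k k by rewrite mulr_ge0 ?ml_coef_ge0.
have [|Bjk] := boolP (0 < B j k); last first.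
  by rewrite ml_coef_gt0 in Bjk; rewrite (ml_coef_eq0 Bjk) mul0r.
have [|Bki] := boolP (0 < B k i); last first.
  by rewrite ml_coef_gt0 in Bki; rewrite (ml_coef_eq0 Bki) mulr0.
move=> /ml_coef_walk[q wq ->] /ml_coef_walk[p wp ->].
rewrite -(path_weight_factor wp wq) ler_pM2r ?ml_coef_diag_gt0 //.
exact/ml_coef_ge/(walk_cat wp wq).
Qed.

Lemma ml_coef_rank j i : 0 < B j i -> j != i ->
  (ancestor_rank j < ancestor_rank i)%N.
Proof. by case/ml_coef_walk => p wp _; apply: ancestor_rank_walk wp. Qed.

(** Cutting a heaviest walk at [k] shows that [B j k * B k i] is at least
    [B j i * B k k]; conversely, if equality holds, then heaviest walks from [j]
    to [k] and from [k] to [i] concatenate to a heaviest one. *)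
Lemma factors_heaviest_walk j k i : 0 < B j i ->
  factors B j k i <->
  exists p, [/\ walk j i p, B j i = path_weight c j p & k \in j :: p].
Proof.
move=> Bji; split => [jki|[p [wp Bp kp]]].
  have [] := factors_gt0 ml_coef_diag_gt0 ml_coef_ge0 Bji jki.
  move=> /ml_coef_walk[p wp Bp] /ml_coef_walk[q wq Bq].
  exists (p ++ q); split; first exact: walk_cat wp wq.
    apply: (mulIf (lt0r_neq0 (ml_coef_diag_gt0 k))).
    by rewrite (path_weight_factor wp wq) -Bp -Bq (eqP jki).
  have /andP[_ /eqP <-] := wp.
  by rewrite -cat_cons mem_cat mem_last.
have [q [r [p_qr wq wr]]] := walk_split kp wp.
rewrite /factors eq_le ml_coef_factor_le Bp p_qr (path_weight_factor wq wr) /=.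
apply: ler_pM; rewrite ?ml_coef_ge //.
  by case/andP: wq => ? _; rewrite ltW // path_weight_gt0.
by case/andP: wr => ? _; rewrite ltW // path_weight_gt0.
Qed.

(** For proper ancestors the walks are nonempty, and the path conditions of the
    two ancestor sets become conditions on factorization. *)
Lemma max_weighted_through (W : {set 'I_d}) j i : j \in an e i ->
  (forall p, max_weighted e c j i p -> ~~ passes_through j p W) <->
  [forall k in W, ~~ factors B j k i].
Proof.
move=> jan; have jAn : j \in An e i by rewrite in_setU1 jan orbT.
have Bji : 0 < B j i by rewrite ml_coef_gt0.
have ji : j != i.
  by apply/eqP => ji; case/anP: jan => p; rewrite ji; apply/negP.
split=> [no_path|/forall_inP no_fac p [/and3P[ep _ lp] Bp]].
  apply/forall_inP => k kW; apply/negP.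
  move=> /(factors_heaviest_walk _ Bji)[p [/andP[ep lp] Bp kp]].
  have := no_path p; rewrite /max_weighted /dipath ep lp -/B Bp andbT.
  have -> : p != [::] by case: (p) lp => //=; rewrite (negbTE ji).
  by move=> /(_ (conj erefl erefl))/hasPn/(_ k kp)/negP.
apply/hasPn => k kp; apply/negP => kW.
have /negP := no_fac k kW; apply; apply/(factors_heaviest_walk _ Bji).
by exists p; split => //; rewrite /walk ep.
Qed.

(** Makes the node [i] itself, from which no path to [i] starts, fit the same
    factorization conditions as its proper ancestors. *)
Lemma not_factors_diag i k : k != i -> ~~ factors B i k i.
Proof.
move=> ki; apply/negP => /(factors_heaviest_walk _ (ml_coef_diag_gt0 i)).
by move=> [p [/closed_walk_nil -> _]]; rewrite inE (negbTE ki).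
Qed.

Lemma An_lowE (U : {set 'I_d}) i : An_low e c U i = low_ancestors B U i.
Proof.
apply/setP => j; rewrite [LHS]inE finset.in_setI [RHS]inE ml_coef_gt0.
rewrite [_ && (j \in U)]andbC -andbA; congr (_ && _); apply: andb_id2l => jAn.
have [ji|ji] := eqVneq j i.
  rewrite ji; apply/asboolP/forall_inP => [_ l|_ p [ip]].
    by rewrite !inE => /andP[li _]; apply: not_factors_diag.
  by have := e_acyclic i p; rewrite ip.
apply/asboolP/idP => /max_weighted_through; apply;
  by move: jAn; rewrite in_setU1 (negbTE ji).
Qed.

Lemma An_nmwE (U : {set 'I_d}) i : An_nmw e c U i = free_ancestors B U i.
Proof.
apply/setP => j; rewrite finset.in_setI in_setU1 finset.in_setC.
rewrite [in LHS]inE [RHS]inE ml_coef_gt0.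
rewrite in_setU1; have [->|ji] /= := eqVneq j i.
  apply/idP/forall_inP => [iU k kU|nf]; last first.
    by apply/negP => /nf; rewrite factors_start.
  by apply: not_factors_diag; apply: contraNneq iU => <-.
rewrite -andbA; apply: andb_id2l => jan.
have /asbool_equiv_eq -> := max_weighted_through U jan.
rewrite asboolb andbC; apply/andb_idl => /forall_inP nf.
by apply/negP => /nf; rewrite factors_start.
Qed.

(** The recursion pushes each noise variable along every path, which gives the
    lower bound; the upper bound is by induction on the topological rank. *)
Lemma ml_solution (x z : 'I_d -> R) :
    (forall j, 0 <= z j) ->
    (forall i, x i = Num.max (\big[Num.max/0]_(k in pa e i) (c k i * x k))
                             (c i i * z i)) ->
  forall i, x i = \big[Num.max/0]_j (B j i * z j).
Proof.
move=> z_ge0 xE.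
have x_ge0 i : 0 <= x i.
  by rewrite xE le_max mulr_ge0 ?orbT // ltW // c_diag_gt0.
have edge_le k i : e k i -> c k i * x k <= x i.
  move=> eki; rewrite [leRHS]xE le_max (@le_bigmax_cond _ _ _ _ k) //.
  by rewrite inE.
have walk_le j p : path e j p -> path_weight c j p * z j <= x (last j p).
  elim/last_ind: p => [|p i IHp].
    by rewrite path_weight_nil /= [leRHS]xE le_max lexx orbT.
  rewrite rcons_path last_rcons path_weight_rcons => /andP[/IHp p_le e_i].
  apply: le_trans (edge_le _ _ e_i).
  by rewrite mulrAC mulrC ler_wpM2l // ltW // c_edge_gt0.
move=> i; apply/le_anti/andP; split; last first.
  apply: bigmax_le => // j _.
  have [jAn|/ml_coef_eq0->] := boolP (j \in An e i); last by rewrite mul0r.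
  have [p [/andP[ep /eqP <-] ->] _] := ml_coef_max jAn; exact: walk_le.
have [n] := ubnP (ancestor_rank i); elim: n i => // n IHn i i_lt.
rewrite [leLHS]xE ge_max; apply/andP; split; last first.
  by rewrite -ml_coef_diag (@le_bigmax _ _ _ _ (fun j => B j i * z j)).
apply: bigmax_le => [|k]; first exact: bigmax0_ge0.
rewrite inE => eki; have cki := c_edge_gt0 eki.
have := IHn k; rewrite (leq_trans (ancestor_rank_edge eki)) //.
move=> /(_ isT) xk_le.
apply: le_trans (ler_wpM2l (ltW cki) xk_le) _.
apply: mul_bigmax_le => [|j _]; first exact: bigmax0_ge0.
apply: (bigmax_sup j) => //.
rewrite mulrA ler_wpM2r //.
have [jAn|/ml_coef_eq0->] := boolP (j \in An e k); last first.
  by rewrite mulr0 ml_coef_ge0.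
have [p [/andP[ep /eqP lp] ->] _] := ml_coef_max jAn.
rewrite mulrC -{1}lp -path_weight_rcons; apply: ml_coef_ge.
by rewrite /walk rcons_path last_rcons ep lp eki eqxx.
Qed.

End Weights.
End Walks.

(** * Identifying max-linear coefficients from the noise *)

Section Probability.

Variables (disp : measure_display) (T : measurableType disp) (R : realType).
Variables (P : probability T R) (d : nat) (Z : 'I_d -> {RV P >-> R}).

(** By independence the box has positive probability, and so it is not contained
    in the exceptional null set. *)
Lemma ae_sample_in_box (Q : T -> Prop) (S : 'I_d -> set R) :
    mutually_independent Z -> (forall j, measurable (S j)) ->
    (forall j, 0 < P (Z j @^-1` S j)%classic)%E -> {ae P, forall w, Q w} ->
  exists2 w, Q w & forall j, S j (Z j w).
Proof.
move=> indZ mS S_gt0 aeQ; apply: contrapT => noQ.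
pose box :=
  (\bigcap_(j in [set j | j \in [set: 'I_d]%SET]) (Z j @^-1` S j))%classic.
have mbox : measurable box.
  apply: fin_bigcap_measurable => // j _.
  by rewrite -[X in measurable X]setTI; apply: measurable_funPT.
have box_neg : P.-negligible box.
  apply: negligibleS aeQ => w wbox /= Qw; apply: noQ; exists w => // j.
  by apply: wbox; rewrite /= inE.
have : (0 < P box)%E.
  have -> : P box = _ := indZ _ _ mS.
  by elim/big_ind : _ => // x y; apply: mule_gt0.
by have -> : P box = 0%E := measure_negligible mbox box_neg; rewrite ltxx.
Qed.

(** If [b j < a j], look where [Z j] exceeds [1] and the other noise variables
    are so small that their terms on the right stay below [a j]: then the
    right-hand side is smaller than [a j * Z j]. *)
Lemma le_max_linear_coef (a b : 'I_d -> R) :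
    mutually_independent Z -> (forall j w, 0 <= Z j w) ->
    (forall j, rv_support (Z j) = [set x | 0 <= x]%classic) ->
    (forall j, 0 <= b j) ->
    {ae P, forall w, \big[Num.max/0]_j (a j * Z j w) =
                     \big[Num.max/0]_j (b j * Z j w)} ->
  forall j, a j <= b j.
Proof.
move=> indZ Z_ge0 suppZ b_ge0 abE j; rewrite leNgt; apply/negP => ba.
have aj_gt0 : 0 < a j by apply: le_lt_trans ba.
(* [M] bounds every [b l], and the summand [1] keeps it positive. *)
pose M := 1 + \sum_l b l.
have b_le l : b l <= M.
  by rewrite /M (bigD1 l) //= addrCA lerDl addr_ge0 // sumr_ge0.
have M_gt0 : 0 < M by rewrite ltr_pwDl // sumr_ge0.
pose S l : set R := if l == j then [set x | 1 < x]%classic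
                    else [set x | x < a j / M]%classic.
have oS l : open (S l).
  by rewrite /S; case: eqP => _; [exact: open_gt | exact: open_lt].
have SZ l : exists2 y, S l y & 0 <= y.
  rewrite /S; case: eqP => _; first by exists 2 => //=; rewrite ltr1n.
  by exists 0 => //=; rewrite divr_gt0.
have [||w wE wS] := ae_sample_in_box indZ _ _ abE (S := S).
- move=> l; rewrite /S; case: eqP => _.
    have <- : `]1, +oo[%classic = [set x : R | 1 < x]%classic.
      by rewrite set_itvE.
    exact: measurable_itv.
  have <- : `]-oo, (a j / M)[%classic = [set x : R | x < a j / M]%classic.
    by rewrite set_itvE.
  exact: measurable_itv.
- move=> l; have [y Sy y_ge0] := SZ l.
  have suppy : rv_support (Z l) y by rewrite suppZ.
  exact: suppy.
have Zj : 1 < Z j w by have := wS j; rewrite /S eqxx.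
have Zj_gt0 : 0 < Z j w by apply: lt_trans Zj.
have : a j * Z j w <= \big[Num.max/0]_l (b l * Z l w).
  by rewrite -wE (@le_bigmax _ _ _ _ (fun l => a l * Z l w)).
apply/negP; rewrite -ltNge; apply/bigmax_ltP; split; first by rewrite mulr_gt0.
move=> l _; have [->|lj] := eqVneq l j; first by rewrite ltr_pM2r.
have Zl : Z l w < a j / M by have := wS l; rewrite /S (negbTE lj).
apply: (@le_lt_trans _ _ (M * (a j / M))).
  apply: (le_trans (ler_wpM2r (Z_ge0 l w) (b_le l))).
  by rewrite ler_pM2l // ltW.
by rewrite mulrC divfK ?gt_eqF // ltr_pMr.
Qed.

End Probability.

(** * The minimal representation *)

(* The numbers of components and of noise variables cannot be minimized
   separately: with A empty and C = An(i) one has a representation without any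
   component of X_U. The number of noise variables is minimal among all
   representations; the number of components of X_U is minimal among those with
   the minimum number of noise variables, and also among those whose noise
   variables lie outside U. *)
Theorem theorem6p7 (disp : measure_display) (T : measurableType disp)
    (R : realType) (P : probability T R) (d : nat) (e : rel 'I_d)
    (c : 'M[R]_d) (Z X : 'I_d -> {RV P >-> R}) (U : {set 'I_d})
    (e_acyclic : acyclic e) (X_model : recursive_ml_model e c Z X)
    (U_nonempty : U != finset.set0) (i : 'I_d) :
  let B := ml_coef e c in
  (forall w, X i w = max_linear X Z (An_low e c U i) (An_nmw e c U i)
                       (fun k => B k i / B k k) (fun j => B j i) w) /\
  (forall (A C : {set 'I_d}) (a b : 'I_d -> R),
     ml_representation X Z U i A C a b ->
     (#|An_nmw e c U i| <= #|C|)%N /\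
     (#|C| = #|An_nmw e c U i| \/ C \subset (~: U)%SET ->
        (#|An_low e c U i| <= #|A|)%N)).
Proof.
move=> B; have [c_gt0 indZ Z_ge0 suppZ X_rec] := X_model.
have Bd := ml_coef_diag_gt0 c_gt0.
have B_ge0 := ml_coef_ge0 e_acyclic c_gt0.
have B_fac := ml_coef_factor_le e_acyclic c_gt0.
have B_rk := ml_coef_rank e_acyclic c_gt0.
rewrite (An_lowE e_acyclic c_gt0) (An_nmwE e_acyclic c_gt0).
have XE w k : X k w = \big[Num.max/0]_j (B j k * Z j w).
  exact: (ml_solution e_acyclic c_gt0 (Z_ge0^~ w) (X_rec^~ w)).
split=> [w|A C a b [AU a_ge0 b_ge0 XiE]].
  exact: (max_linear_low_free Bd B_ge0 B_fac B_rk U i (Z_ge0^~ w) (XE w)).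
pose m := noise_coef B A C a b.
have m_ge0 j : 0 <= m j by rewrite le_max bigmax0_ge0.
have X_m w : max_linear X Z A C a b w = \big[Num.max/0]_j (m j * Z j w).
  exact: (max_linear_noise C b (Z_ge0^~ w) (XE w) a_ge0).
have aeE : {ae P, forall w, \big[Num.max/0]_j (B j i * Z j w) =
                            \big[Num.max/0]_j (m j * Z j w)}.
  by apply: filterS XiE => w; rewrite X_m XE.
have aeE' : {ae P, forall w, \big[Num.max/0]_j (m j * Z j w) =
                            \big[Num.max/0]_j (B j i * Z j w)}.
  by apply: filterS aeE => w.
have BE j : B j i = m j.
  apply/le_anti/andP; split.
    exact: (le_max_linear_coef indZ Z_ge0 suppZ m_ge0 aeE).
  exact: (le_max_linear_coef indZ Z_ge0 suppZ _ aeE').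
have nmwC := free_ancestors_sub Bd B_ge0 B_fac AU BE.
split=> [|C_min]; first exact: subset_leq_card.
apply/subset_leq_card/(low_ancestors_sub Bd B_ge0 B_fac AU BE).
case: C_min => // C_card.
have /eqP <- : free_ancestors B U i == C by rewrite eqEcard nmwC C_card leqnn.
apply/fintype.subsetP => j; rewrite !inE => /andP[_ /forall_inP nf].
by apply/negP => /nf; rewrite factors_start.
Qed.
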